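(* Let $X$ and $Y$ be completely regular topological spaces, let $f:X\times Y\to[-\infty,+\infty]$ be an extended real-valued function and let $K:X\rightrightarrows Y$ be a set-valued mapping with nonempty images. Suppose that: (i) the function $w(x):=\inf_{y\in Kx} f(x,y)$, $x\in X$, is bounded from above on $X$ and is proper as a function with values in $\mathbb{R}\cup\{-\infty\}$ (i.e. it has at least one finite value); (ii) $f$ is continuous on $X\times Y$ as a function into $[-\infty,+\infty]$; (iii) $K$ is both lower semicontinuous and upper semicontinuous in $X$ and has compact images. Let $S_f:C(X)\times C(Y)\rightrightarrows X\times Y$ be the solution mapping that assigns to $(g,h)$ the (possibly empty) set of solutions of the supinf problem $\sup_{x\in X}\inf_{y\in Kx}\{f(x,y)+g(x)+h(y)\}$. Then: (a) the domain $\mathrm{Dom}(S_f)$ is dense in $C(X)\times C(Y)$; (b) the graph $\mathrm{Gr}(S_f)$ is closed in the product topology of $(C(X)\times C(Y))\times(X\times Y)$; (c) the mapping $S_f$ is quasi-continuous; (d) the mapping $S_f$ is open as a mapping from $C(X)\times C(Y)$ into $\mathrm{Gr}(K)$.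
   Context: Completely regular spaces are understood to be Hausdorff. $X\times Y$ carries the product topology, and $[-\infty,+\infty]$ its usual extended (order) topology. For a topological space $Z$, $C(Z)$ is the Banach space of all bounded continuous real-valued functions on $Z$ with the sup norm $\|g\|_{Z,\infty}=\sup_{z\in Z}|g(z)|$; $C(X)\times C(Y)$ carries a usual product norm (inducing the product topology). For a function $F:X\times Y\to[-\infty,+\infty]$, a solution of the supinf problem $\sup_{x\in X}\inf_{y\in Kx}F(x,y)$ is a pair $(x_0,y_0)\in X\times Y$ with $y_0\in Kx_0$ and $F(x_0,y_0)=\inf_{y\in Kx_0}F(x_0,y)=\sup_{x\in X}\inf_{y\in Kx}F(x,y)$. For a set-valued mapping $\Phi:Z\rightrightarrows T$ between topological spaces (values may be empty): $\mathrm{Dom}(\Phi)=\{z\in Z:\Phi(z)\neq\emptyset\}$; $\mathrm{Gr}(\Phi)=\{(z,t):t\in\Phi(z)\}$; $\Phi(U)=\bigcup_{z\in U}\Phi(z)$. $\Phi$ is upper semicontinuous (usc) at $z_0$ if for every open $V\supset\Phi(z_0)$ there is an open $U\ni z_0$ with $\Phi(z)\subset V$ for all $z\in U$. A $\Phi$ with nonempty images is lower semicontinuous (lsc) at $z_0$ if for every open $V$ with $V\cap\Phi(z_0)\neq\emptyset$ there is an open $U\ni z_0$ with $\Phi(z)\cap V\ne\emptyset$ for all $z\in U$. $\Phi$ is usc (lsc) in $Z$ if it is so at every point. $\Phi$ is quasi-continuous if for all open $U\subset Z$ and $V\subset T$ with $\Phi(U)\cap V\neq\emptyset$ there is a nonempty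 open $U'\subset U$ with $\Phi(U')\subset V$. $S_f$ is open into $\mathrm{Gr}(K)$ if for every open $O\subset C(X)\times C(Y)$ the set $S_f(O)$ is an open subset of $\mathrm{Gr}(K)$, where $\mathrm{Gr}(K)\subset X\times Y$ has the subspace topology. *)

(* Defs.v *)
From HB Require Import structures.
From mathcomp Require Import all_boot all_order all_algebra.
From mathcomp Require Import all_classical all_reals all_analysis.

Set Implicit Arguments.
Unset Strict Implicit.
Unset Printing Implicit Defensive.

Import Order.TTheory GRing.Theory Num.Theory.
Import numFieldNormedType.Exports.

Local Open Scope classical_set_scope.
Local Open Scope ring_scope.

(* The space C(Z), as a normed module for the sup norm. On an empty Z the norm
   is [sup set0 = 0]. *)
Section bounded_continuous.
Context (R : realType) (Z : topologicalType).

Definition bcont : {pred Z -> R} :=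
  [pred g | `[< continuous (g : Z -> R) /\ bounded_fun (g : Z -> R) >]].

Lemma bcontP (g : Z -> R) :
  reflect (continuous g /\ exists M : R, forall z, `|g z| <= M) (g \in bcont).
Proof.
apply: (iffP idP) => [/asboolP[cg [M [_ gM]]]|[cg [M gM]]].
  split=> //; exists (M + 1) => z; apply: gM => //.
  by rewrite ltrDl.
apply/asboolP; split=> //; exists M; split; first exact: num_real.
by move=> x Mx z _; exact: le_trans (gM z) (ltW Mx).
Qed.

Lemma bcont_submod_closed : submod_closed bcont.
Proof.
split; first by apply/bcontP; split=> [z|]; [exact: cvg_cst|
  exists 0 => z; rewrite normr0].
move=> a g h /bcontP[cg [M gM]] /bcontP[ch [N hN]]; apply/bcontP; split.
  move=> z; apply: cvgD; last exact: ch.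
  by apply: cvgM; [exact: cvg_cst|exact: cg].
exists (`|a| * M + N) => z; apply: (le_trans (ler_normD _ _)).
by rewrite lerD // normrM ler_wpM2l.
Qed.

HB.instance Definition _ :=
  GRing.isSubmodClosed.Build R (Z -> R) bcont bcont_submod_closed.

Record bcfun := BCFun { bcfun_fun :> Z -> R; bcfunP : bcfun_fun \in bcont }.

HB.instance Definition _ := [isSub for bcfun_fun].
HB.instance Definition _ := [Choice of bcfun by <:].
HB.instance Definition _ := [SubChoice_isSubLmodule of bcfun by <:].

Definition supnorm (g : bcfun) : R := sup [set `|g z| | z in [set: Z]].

Lemma supnorm_le (g : bcfun) (z : Z) : `|g z| <= supnorm g.
Proof.
have /bcontP[_ [M gM]] := bcfunP g.
apply: ub_le_sup; last by exists z.
by exists M => _ [t _ <-].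
Qed.

Lemma supnorm_lub (g : bcfun) (M : R) :
  0 <= M -> (forall z, `|g z| <= M) -> supnorm g <= M.
Proof.
move=> M0 gM; have [[z _]|/set0P/negP/negPn/eqP Z0] := pselect ([set: Z] !=set0).
  by apply: ge_sup; [exists `|g z|, z|move=> _ [t _ <-]].
by rewrite /supnorm Z0 image_set0 sup0.
Qed.

Lemma supnorm_ge0 (g : bcfun) : 0 <= supnorm g.
Proof.
have [[z _]|/set0P/negP/negPn/eqP Z0] := pselect ([set: Z] !=set0).
  exact: le_trans (supnorm_le g z).
by rewrite /supnorm Z0 image_set0 sup0.
Qed.

Lemma supnormD (g h : bcfun) : supnorm (g + h) <= supnorm g + supnorm h.
Proof.
apply: supnorm_lub => [|z]; first by rewrite addr_ge0 ?supnorm_ge0.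
by apply: (le_trans (ler_normD _ _)); rewrite lerD ?supnorm_le.
Qed.

Lemma supnormZ_le (a : R) (g : bcfun) : supnorm (a *: g) <= `|a| * supnorm g.
Proof.
apply: supnorm_lub => [|z]; first by rewrite mulr_ge0 ?supnorm_ge0.
by rewrite [leLHS](normrM a (g z)) ler_wpM2l ?supnorm_le.
Qed.

Lemma supnormZ (a : R) (g : bcfun) : supnorm (a *: g) = `|a| * supnorm g.
Proof.
apply/eqP; rewrite eq_le supnormZ_le /=.
have [->|a0] := eqVneq a 0; first by rewrite normr0 mul0r supnorm_ge0.
rewrite -ler_pdivlMl ?normr_gt0 // -normfV.
by apply: le_trans (supnormZ_le _ _); rewrite scalerA mulVf ?scale1r.
Qed.

Lemma supnorm0_eq0 (g : bcfun) : supnorm g = 0 -> g = 0.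
Proof.
move=> g0; apply/val_inj/funext => z /=.
by apply/eqP; rewrite -normr_le0 -g0 supnorm_le.
Qed.

HB.instance Definition _ :=
  Lmodule_isNormed.Build R bcfun supnormD supnormZ supnorm0_eq0.

End bounded_continuous.

Section set_valued.
Context (Z T : topologicalType).
Implicit Types (Phi : Z -> set T) (U : set Z).

Definition svdom Phi : set Z := [set z | Phi z !=set0].

Definition svgraph Phi : set (Z * T) := [set p | Phi p.1 p.2].

Definition svimage Phi U : set T := \bigcup_(z in U) Phi z.

Definition usc Phi : Prop := forall z0 : Z,
  forall V : set T, open V -> Phi z0 `<=` V ->
    exists U : set Z, [/\ open U, U z0 & forall z, U z -> Phi z `<=` V].

Definition lsc Phi : Prop := forall z0 : Z,
  forall V : set T, open V -> V `&` Phi z0 !=set0 ->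
    exists U : set Z, [/\ open U, U z0 & forall z, U z -> Phi z `&` V !=set0].

Definition quasi_continuous Phi : Prop :=
  forall (U : set Z) (V : set T), open U -> open V ->
    svimage Phi U `&` V !=set0 ->
    exists U' : set Z,
      [/\ open U', U' !=set0, U' `<=` U & svimage Phi U' `<=` V].

(* Relatively open subsets of [G] are spelled out as traces [W `&` G] of open
   sets; the library's [subspace G] also contains the points outside [G]. *)
Definition open_into Phi (G : set T) : Prop :=
  forall O : set Z, open O ->
    exists2 W : set T, open W & svimage Phi O = W `&` G.

End set_valued.

Section supinf.
Context (R : realType) (X Y : Type).
Local Open Scope ereal_scope.

Definition inf_value (K : X -> set Y) (F : X * Y -> \bar R) (x : X) : \bar R :=
  ereal_inf [set F (x, y) | y in K x].

Definition supinf_value (K : X -> set Y) (F : X * Y -> \bar R) : \bar R :=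
  ereal_sup [set inf_value K F x | x in [set: X]].

Definition supinf_solution (K : X -> set Y) (F : X * Y -> \bar R) :
    set (X * Y) :=
  [set p | [/\ K p.1 p.2, F p = inf_value K F p.1 &
               inf_value K F p.1 = supinf_value K F]].

End supinf.

Definition solution_map (R : realType) (X Y : topologicalType)
    (f : X * Y -> \bar R) (K : X -> set Y)
    (gh : bcfun R X * bcfun R Y) : set (X * Y) :=
  supinf_solution K (fun p => f p + (gh.1 p.1)%:E + (gh.2 p.2)%:E)%E.

(* Main.v *)
Require Import Defs.
From HB Require Import structures.
From mathcomp Require Import all_boot all_order all_algebra.
From mathcomp Require Import all_classical all_reals all_analysis.
From mathcomp Require Import lra.
Import Order.TTheory GRing.Theory Num.Theory.
Import numFieldNormedType.Exports.
Local Open Scope classical_set_scope.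
Local Open Scope ring_scope.

Set Implicit Arguments.
Unset Strict Implicit.
Unset Printing Implicit Defensive.

(** Write [w] for the value function of the perturbed problem [(g, h)], the
infimum over [y] in [K x] of [f (x, y) + g x + h y]. The hypotheses on [K] and
[f] enter mostly through Berge's maximum theorem ([inf_value_continuous]): the
infimum of a continuous payoff over a continuous compact-valued correspondence
depends continuously on the parameter. Used with the pair [((g, h), x)] as
parameter, it makes [w] jointly continuous in the perturbation and the point.

A point [(x, y)] of the graph of [K] solves the problem [(g, h)] exactly when
its payoff is at most [w x] and at least every [w x'] ([supinf_solutionP]).
These are non-strict inequalities between jointly continuous functions, and
the graph of a usc map with closed values in a regular space is closed; this is
the closedness of the graph of the solution map.

Density and openness both follow from [solution_by_perturbation]: a point
[(x0, y0)] of the graph of [K] that solves the problem up to an error [e]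
solves exactly a perturbed problem at a distance proportional to [e]. With [a]
the payoff at [(x0, y0)], adding to [h] the positive part of
[a - payoff (x0, y)] (truncated at [e]) makes [y0] a minimizer over [K x0]
without changing the payoff at [y0]; then subtracting from [g] the positive
part of [w x - a] (truncated at [2 e]), for the new [w], makes [x0] a maximizer.
The penalties are built from the data, and they are continuous by Berge's
theorem. Approximate solutions always exist, whence density; and the points of
the graph of [K] close to an exact solution are approximate solutions, whence
openness.

For quasi-continuity, an exact solution [(x0, y0)] in an open set [V] is turned
into a strict one: complete regularity provides bumps around [x0] and [y0], and
rewarding the maximizer near [x0] (add a bump to [g]) and the minimizer near
[y0] (subtract a smaller bump from [h]) creates gaps that survive small further
perturbations. All solutions of all problems close to the modified one then lie
in [V]. *)

(** * Continuous functions with values in the extended reals *)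

Lemma ereal_lt_real_between (R : realType) (a b : \bar R) :
  (a < b)%E -> exists r : R, (a < r%:E)%E /\ (r%:E < b)%E.
Proof.
case: a => [a||]; case: b => [b||] //= ab.
- by exists ((a + b) / 2); move: ab; rewrite !lte_fin => ab; split; lra.
- by exists (a + 1); rewrite lte_fin ltry; split => //; lra.
- by exists (b - 1); rewrite lte_fin ltNyr; split => //; lra.
- by exists 0; rewrite ltNyr ltry.
Qed.

Lemma near_lt_ereal_fun (R : realType) (T : topologicalType)
    (u v : T -> \bar R) (t : T) :
  continuous u -> continuous v -> (u t < v t)%E ->
  \forall s \near t, (u s < v s)%E.
Proof.
move=> cu cv /ereal_lt_real_between[r [ur rv]].
have Nu : \forall s \near t, (u s < r%:E)%E.
  by apply: (cu t [set z | (z < r%:E)%E]); apply: open_nbhs_nbhs;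
    split => //; exact: open_ereal_lt_ereal.
have Nv : \forall s \near t, (r%:E < v s)%E.
  by apply: (cv t [set z | (r%:E < z)%E]); apply: open_nbhs_nbhs;
    split => //; exact: open_ereal_gt_ereal.
by near=> s; apply: (@lt_trans _ _ r%:E); near: s.
Unshelve. all: by end_near. Qed.

Lemma open_lt_ereal_fun (R : realType) (T : topologicalType)
    (u v : T -> \bar R) :
  continuous u -> continuous v -> open [set t | (u t < v t)%E].
Proof. by move=> cu cv; rewrite openE => t; exact: near_lt_ereal_fun. Qed.

Lemma closed_le_ereal_fun (R : realType) (T : topologicalType)
    (u v : T -> \bar R) :
  continuous u -> continuous v -> closed [set t | (u t <= v t)%E].
Proof.
move=> cu cv.
have -> : [set t | (u t <= v t)%E] = ~` [set t | (v t < u t)%E].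
  by apply/seteqP; split=> t /=; rewrite leNgt => /negP.
exact/open_closedC/open_lt_ereal_fun.
Qed.

(** Continuity of a value function is proved one ray at a time, since the two
halves come from different semicontinuity properties of the constraint. *)
Lemma continuous_ereal_rays (R : realType) (T : topologicalType)
    (u : T -> \bar R) :
  (forall (r : R) t, (r%:E < u t)%E -> \forall s \near t, (r%:E < u s)%E) ->
  (forall (r : R) t, (u t < r%:E)%E -> \forall s \near t, (u s < r%:E)%E) ->
  continuous u.
Proof.
move=> ul uu t A; change (ereal_nbhs (u t) A -> \forall s \near t, A (u s)).
case E : (u t) => [a||] /=.
- move=> /nbhs_ballP[e /= e0 eA].
  have l : \forall s \near t, ((a - e)%:E < u s)%E.
    by apply: ul; rewrite E lte_fin; lra.
  have h : \forall s \near t, (u s < (a + e)%:E)%E.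
    by apply: uu; rewrite E lte_fin; lra.
  near=> s.
  have : ((a - e)%:E < u s)%E by near: s.
  have : (u s < (a + e)%:E)%E by near: s.
  case us : (u s) => [b||] //; rewrite !lte_fin => bl bu.
  by apply: eA; rewrite /ball /= ltr_norml; apply/andP; split; lra.
- case=> M [_ MA]; have := ul M t; rewrite E ltry => /(_ isT).
  by apply: filterS => s; exact: MA.
- case=> M [_ MA]; have := uu M t; rewrite E ltNyr => /(_ isT).
  by apply: filterS => s; exact: MA.
Unshelve. all: by end_near. Qed.

(** * Berge's maximum theorem *)

Section berge.
Context (R : realType) (Z T : topologicalType).
Context (Phi : Z -> set T).
Context (F : Z * T -> \bar R).
Local Open Scope ereal_scope.

(** The tube lemma for a usc map: by compactness of [Phi z], the set [O]
contains a product of a neighborhood [W] of [z] and an open set around [Phi z];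
upper semicontinuity keeps [Phi z'] inside that open set. *)
Lemma usc_tube (O : set (Z * T)) (z : Z) :
  usc Phi -> compact (Phi z) -> open O -> (forall t, Phi z t -> O (z, t)) ->
  \forall z' \near z, forall t, Phi z' t -> O (z', t).
Proof.
move=> Phi_usc /compact_near_coveringP Phic oO Oz.
have [W [Wz PW]] : exists W, nbhs z W /\ Phi z `<=`
    [set t | \forall t' \near t, forall z', W z' -> O (z', t')].
  have N : \forall W \near powerset_filter_from (nbhs z), Phi z `<=`
    [set t | \forall t' \near t, forall z', W z' -> O (z', t')].
    apply: Phic => t /Oz Ot.
    have [[A B] /= [Az Bt] AB] : nbhs (z, t) O by exact: open_nbhs_nbhs.
    exists (B°, [set W | W `<=` A]); first split => /=.
    - exact: nbhs_interior.
    - exact: small_set_sub.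
    case=> t' W [/= Bt' WA]; apply: filterS Bt' => t'' Bt'' z' Wz'.
    by apply: (AB (z', t'')); split => //; exact: WA.
  near (powerset_filter_from (nbhs z)) => W.
  by exists W; split; near: W => //; exact: near_small_set.
pose V := [set t' | forall z', W z' -> O (z', t')]°.
have [U [oU Uz UV]] := Phi_usc z V (open_interior _) PW.
have NU : nbhs z U by exact: open_nbhs_nbhs.
near=> z' => t Phit.
apply: (interior_subset (UV z' _ _ Phit)); first by near: z'.
by near: z'.
Unshelve. all: by end_near. Qed.

Lemma inf_value_le z t : Phi z t -> inf_value Phi F z <= F (z, t).
Proof. by move=> zt; apply: ereal_inf_lbound; exists t. Qed.

Lemma inf_value_ge z c :
  (forall t, Phi z t -> c <= F (z, t)) -> c <= inf_value Phi F z.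
Proof. by move=> cF; apply: le_ereal_inf_tmp => _ [t zt <-]; exact: cF. Qed.

(** A real [b] strictly between [r] and the infimum at [z] keeps the inequality
strict for nearby infima, so that no minimizer has to be produced. *)
Lemma inf_value_lower (r : R) z : usc Phi -> (forall z, compact (Phi z)) ->
  continuous F -> r%:E < inf_value Phi F z ->
  \forall z' \near z, r%:E < inf_value Phi F z'.
Proof.
move=> Phi_usc Phic Fc /ereal_lt_real_between[b [rb bF]].
have oO : open [set p | b%:E < F p].
  by apply: open_lt_ereal_fun => //; exact: cst_continuous.
have : \forall z' \near z, forall t, Phi z' t -> b%:E < F (z', t).
  apply: (@usc_tube [set p | b%:E < F p]) => // t /inf_value_le.
  exact: lt_le_trans.
apply: filterS => z' bF'; apply: (lt_le_trans rb).
by apply: inf_value_ge => t /bF' /ltW.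
Qed.

Lemma inf_value_upper (r : R) z : lsc Phi -> continuous F ->
  inf_value Phi F z < r%:E -> \forall z' \near z, inf_value Phi F z' < r%:E.
Proof.
move=> Phi_lsc Fc /ereal_inf_lt[_ [t zt <-] Fr].
have oO : open [set p | F p < r%:E].
  by apply: open_lt_ereal_fun => //; exact: cst_continuous.
have [[A B] /= [Az Bt] AB] : nbhs (z, t) [set p | F p < r%:E].
  exact: open_nbhs_nbhs.
have [|U [oU Uz UB]] := Phi_lsc z B° (open_interior _).
  by exists t; split => //; exact: nbhs_singleton (nbhs_interior Bt).
have NU : nbhs z U by exact: open_nbhs_nbhs.
near=> z'.
have /UB[t' [zt' /interior_subset Bt']] : U z' by near: z'.
apply: le_lt_trans (inf_value_le zt') _.
by apply: (AB (z', t')); split => //=; near: z'.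
Unshelve. all: by end_near. Qed.

Lemma inf_value_continuous : usc Phi -> lsc Phi ->
  (forall z, compact (Phi z)) -> continuous F -> continuous (inf_value Phi F).
Proof.
move=> Phi_usc Phi_lsc Phic Fc; apply: continuous_ereal_rays => r z.
- exact: inf_value_lower.
- exact: inf_value_upper.
Qed.

End berge.

Lemma inf_value_leD (R : realType) (X Y : Type) (K : X -> set Y)
    (F G : X * Y -> \bar R) (x : X) (c : R) :
  (forall y, K x y -> (F (x, y) <= G (x, y) + c%:E)%E) ->
  (inf_value K F x <= inf_value K G x + c%:E)%E.
Proof.
move=> FG; rewrite -leeBlDr//; apply: le_ereal_inf_tmp => _ [y Kxy <-].
rewrite leeBlDr//; apply: le_trans (FG y Kxy).
by apply: ereal_inf_lbound; exists y.
Qed.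

(** * Composition and graphs *)

Section continuous_maps.
Context (A B C : topologicalType).

Lemma continuous_pair (u : A -> B) (v : A -> C) :
  continuous u -> continuous v -> continuous (fun a => (u a, v a)).
Proof. by move=> cu cv a; exact: cvg_pair (cu a) (cv a). Qed.

Lemma continuous_compose (u : A -> B) (v : B -> C) :
  continuous u -> continuous v -> continuous (v \o u).
Proof. by move=> cu cv a; exact: continuous_comp (cu a) (cv _). Qed.

Lemma continuous_fst : continuous (@fst A B).
Proof. by move=> a; exact: cvg_fst. Qed.

Lemma continuous_snd : continuous (@snd A B).
Proof. by move=> a; exact: cvg_snd. Qed.

End continuous_maps.

Section preimage.
Context (Z' Z T : topologicalType) (u : Z' -> Z) (Phi : Z -> set T).
Context (u_cont : continuous u).

Lemma usc_comp : usc Phi -> usc (Phi \o u).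
Proof.
move=> Phi_usc z V oV /(Phi_usc _ _ oV)[U [oU Uz UV]].
exists (u @^-1` U); split => // [|z' /UV//].
by move/continuousP : u_cont; exact.
Qed.

Lemma lsc_comp : lsc Phi -> lsc (Phi \o u).
Proof.
move=> Phi_lsc z V oV /(Phi_lsc _ _ oV)[U [oU Uz UV]].
exists (u @^-1` U); split => // [|z' /UV//].
by move/continuousP : u_cont; exact.
Qed.

End preimage.

Lemma svgraph_closed (Z T : topologicalType) (Phi : Z -> set T) :
  @regular_space T -> usc Phi -> (forall z, closed (Phi z)) ->
  closed (svgraph Phi).
Proof.
move=> regT Phi_usc Phic; rewrite -openC openE => -[z t] /= Nt.
have [A [B [oA oB At PB AB]]] :=
  (@regular_openP T t).1 (@regT t) _ (Phic z) Nt.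
have [U [oU Uz UB]] := Phi_usc z B oB PB.
exists (U, A); first by split; exact: open_nbhs_nbhs.
move=> [z' t'] /= [Uz' At'] Phit'.
have : (A `&` B) t' by split => //; exact: (UB z').
by rewrite AB.
Qed.

(** * Bounded continuous functions *)

Section bcfun_lemmas.
Context (R : realType) (Z : topologicalType).
Implicit Types (g : bcfun R Z).

Lemma bcfun_le_norm g z : `|g z| <= `|g|.
Proof. exact: supnorm_le. Qed.

Lemma bcfun_norm_le g (M : R) : 0 <= M -> (forall z, `|g z| <= M) -> `|g| <= M.
Proof. exact: supnorm_lub. Qed.

Lemma bcfun_continuous g : continuous g.
Proof. by have /bcontP[] := bcfunP g. Qed.

Lemma bcfun_ball g g' (e : R) z : ball g e g' -> `|g z - g' z| < e.
Proof.
rewrite -ball_normE /= => /(le_lt_trans _); apply.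
exact: (bcfun_le_norm (g - g')).
Qed.

Lemma bcfun_eval_continuous : continuous (fun q : bcfun R Z * Z => q.1 q.2).
Proof.
move=> [g z] /=; apply/cvgrPdist_lt => e e0.
have e2 : 0 < e / 2 by rewrite divr_gt0.
have Ng : nbhs g (ball g (e / 2)) by exact: nbhsx_ballx.
have Nz : \forall z' \near z, `|g z - g z'| < e / 2.
  by have /cvgrPdist_lt := @bcfun_continuous g z; exact.
exists (ball g (e / 2), [set z' | `|g z - g z'| < e / 2]) => //=.
case=> g' z' /= [/(@bcfun_ball _ _ _ z') gg' gz].
rewrite (splitr e) -(subrKA (g z')).
by apply: le_lt_trans (ler_normD _ _) _; exact: ltrD.
Qed.

Lemma bcfun_build (u : Z -> R) (d : R) : continuous u ->
  (forall z, 0 <= u z <= d) -> 0 <= d ->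
  exists k : bcfun R Z, (k = u :> (Z -> R)) /\ `|k| <= d.
Proof.
move=> cu ud d0.
have nu z : `|u z| <= d by have /andP[u0 ?] := ud z; rewrite ger0_norm.
have ub : u \in @bcont R Z by apply/bcontP; split => //; exists d.
by exists (BCFun ub); split => //; exact: bcfun_norm_le.
Qed.

(** Truncating an extended-real function [u] to the interval from [0] to [d]
gives a perturbation of norm at most [d] that vanishes where [u] is nonpositive
and dominates [u] wherever [u] is at most [d]. *)
Lemma bcfun_truncation (u : Z -> \bar R) (d : R) : continuous u -> 0 <= d ->
  exists k : bcfun R Z, [/\ `|k| <= d, forall z, 0 <= k z,
    forall z, (u z <= 0)%E -> k z = 0 &
    forall z, (u z <= d%:E)%E -> (u z <= (k z)%:E)%E].
Proof.
move=> cu d0.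
pose v z := maxe 0%E (mine (u z) d%:E).
have vd z : exists2 r : R, v z = r%:E & 0 <= r <= d.
  rewrite /v; case: (u z) => [r||].
  - exists (Num.max 0 (Num.min r d)); first by rewrite EFin_max EFin_min.
    by rewrite le_max lexx /= ge_max d0 ge_min lexx orbT.
  - exists d; last by rewrite d0 lexx.
    by rewrite min_r ?leey// max_r.
  - by exists 0; rewrite ?lexx// min_l ?leNye// max_l ?leNye.
have cv : continuous v.
  apply: max_fun_continuous; first exact: cst_continuous.
  by apply: min_fun_continuous => //; exact: cst_continuous.
have [|z||k [kE kd]] := @bcfun_build (fine \o v) d.
- move=> z; have [r vr _] := vd z.
  by apply: fine_cvg; rewrite /= vr -vr; exact: cv.
- by have [r /= -> ] := vd z.
- by [].
exists k; split => // z; rewrite kE /=.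
- by have [r /= -> /andP[]] := vd z.
- by move=> uz0; rewrite /v min_l ?max_l// (le_trans uz0).
- move=> uzd; have [r vr _] := vd z; rewrite vr /= -vr /v min_l//.
  by rewrite le_max lexx orbT.
Qed.

Lemma bcfun_bump (z : Z) (V : set Z) (d : R) : completely_regular_space Z ->
  nbhs z V -> 0 <= d ->
  exists k : bcfun R Z, [/\ `|k| <= d, k z = d, forall z', 0 <= k z' <= d &
    forall z', ~ V z' -> k z' = 0].
Proof.
move=> crZ zV d0.
have /(crZ z) : closed (~` V°) by exact/open_closedC/open_interior.
move=> /(_ (fun h => h (nbhs_singleton (nbhs_interior zV)))).
move=> /(@uniform_separatorP _ R)[u [cu u01 uz uV]].
have u01' z' : 0 <= u z' <= 1 by have := u01 _ (imageT u z'); rewrite /= in_itv.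
have [|z'||k [kE kd]] := @bcfun_build (fun z' => d * (1 - u z')) d.
- move=> z'; apply: cvgM; first exact: cvg_cst.
  by apply: cvgB; [exact: cvg_cst|exact: cu].
- by have := u01' z'; nra.
- by [].
exists k; rewrite kE; split => //.
- have -> : u z = 0 by apply: uz; exists z.
  by rewrite subr0 mulr1.
- by move=> z'; have := u01' z'; nra.
- move=> z' Vz'; have -> : u z' = 1.
    by apply: uV; exists z' => // /interior_subset.
  by rewrite subrr mulr0.
Qed.

End bcfun_lemmas.

(** * Solutions of a supinf problem *)

Section solutions.
Context (R : realType) (X Y : Type) (K : X -> set Y) (F : X * Y -> \bar R).
Local Open Scope ereal_scope.

(** The supinf value disappears from this description of solutions,
leaving only inequalities, which pass to limits. *)
Lemma supinf_solutionP p : supinf_solution K F p <->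
  [/\ K p.1 p.2, F p <= inf_value K F p.1 & forall x, inf_value K F x <= F p].
Proof.
case: p => x y /=; split.
- case=> /= Kxy -> E; split => // x'; rewrite E.
  by apply: ereal_sup_ubound; exists x'.
- case=> Kxy Fw wF.
  have E : F (x, y) = inf_value K F x by apply/eqP; rewrite eq_le Fw wF.
  split => //=; apply/eqP; rewrite eq_le; apply/andP; split.
  + by apply: ereal_sup_ubound; exists x.
  + by apply: ge_ereal_sup => _ [x' _ <-]; rewrite -E.
Qed.

End solutions.

(** * The perturbed problems *)

Section perturbed_problem.
Context (R : realType) (X Y : topologicalType).
Context (f : X * Y -> \bar R) (K : X -> set Y).
Implicit Types (gh : bcfun R X * bcfun R Y).
Local Open Scope ereal_scope.

Definition payoff gh (p : X * Y) : \bar R :=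
  f p + (gh.1 p.1)%:E + (gh.2 p.2)%:E.

(** The value function [w] of the problem [(g, h)]: the payoff that the
maximizing player is sure of when choosing [x]. *)
Definition guaranteed gh (x : X) : \bar R := inf_value K (payoff gh) x.

(** Comparisons of payoffs reduce to real inequalities: at an infinite value of
[f] the perturbation has no effect. *)
Lemma payoff_leD gh gh' p (c : R) :
  (gh'.1 p.1 + gh'.2 p.2 <= gh.1 p.1 + gh.2 p.2 + c)%R ->
  payoff gh' p <= payoff gh p + c%:E.
Proof.
rewrite /payoff; case: (f p) => [r||] //= gh'c.
by rewrite -!EFinD lee_fin; lra.
Qed.

Lemma perturbation_ball gh gh' p (e : R) : ball gh e gh' ->
  (`|(gh.1 p.1 + gh.2 p.2) - (gh'.1 p.1 + gh'.2 p.2)| <= 2 * e)%R.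
Proof.
case=> /(@bcfun_ball _ _ _ _ _ p.1) + /(@bcfun_ball _ _ _ _ _ p.2).
rewrite !ltr_norml ler_norml => /andP[? ?] /andP[? ?].
by apply/andP; split; lra.
Qed.

(** A perturbation shifts the value function by at most [`|g| + `|h|], so the
bound from above and the finite value for [f] itself give a finite value for
every perturbed problem. *)
Lemma supinf_value_fin gh :
  (exists M : R, forall x, inf_value K f x <= M%:E) ->
  (exists x, inf_value K f x \is a fin_num) ->
  exists v : R, supinf_value K (payoff gh) = v%:E.
Proof.
case=> M wM [x0 wx0].
pose N : R := (`|gh.1| + `|gh.2|)%R.
have ghN x y : (- N <= gh.1 x + gh.2 y <= N)%R.
  have := bcfun_le_norm gh.1 x; have := bcfun_le_norm gh.2 y.
  rewrite !ler_norml /N => /andP[? ?] /andP[? ?]; apply/andP; split; lra.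
have up x : guaranteed gh x <= (M + N)%:E.
  apply: (@le_trans _ _ (inf_value K f x + N%:E)); last first.
    by rewrite EFinD; exact: leeD2r (wM x).
  apply: inf_value_leD => y _; rewrite /payoff /=.
  have := ghN x y; case: (f (x, y)) => [r||] //= ?.
  by rewrite -!EFinD lee_fin; lra.
have lo : inf_value K f x0 <= guaranteed gh x0 + N%:E.
  apply: inf_value_leD => y _; rewrite /payoff /=.
  have := ghN x0 y; case: (f (x0, y)) => [r||] //= ?.
  by rewrite -!EFinD lee_fin; lra.
have ge0 : guaranteed gh x0 <= supinf_value K (payoff gh).
  by apply: ereal_sup_ubound; exists x0.
have : supinf_value K (payoff gh) <= (M + N)%:E.
  by apply: ge_ereal_sup => _ [x _ <-]; exact: up.
have := le_trans lo (leeD2r N%:E ge0).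
move: wx0; case: (inf_value K f x0) => // w _.
by case: (supinf_value _ _) => [v||] // _ _; exists v.
Qed.

Context (f_cont : continuous f).

Lemma payoff_continuous :
  continuous (fun q : (bcfun R X * bcfun R Y) * (X * Y) => payoff q.1 q.2).
Proof.
move=> [[g h] [x y]] /=; rewrite /payoff /=.
apply: cvgeD; first by rewrite fin_num_adde_defl.
- apply: cvgeD; first by rewrite fin_num_adde_defl.
  + exact: (continuous_compose (@continuous_snd _ _) f_cont).
  + apply: cvg_EFin; first exact: nearW.
    apply: (@continuous_compose _ _ _
      (fun q : (bcfun R X * bcfun R Y) * (X * Y) => (q.1.1, q.2.1))
      (fun q : bcfun R X * X => q.1 q.2)); last exact: bcfun_eval_continuous.
    by apply: continuous_pair; apply: continuous_compose;
      (exact: continuous_fst || exact: continuous_snd).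
- apply: cvg_EFin; first exact: nearW.
  apply: (@continuous_compose _ _ _
    (fun q : (bcfun R X * bcfun R Y) * (X * Y) => (q.1.2, q.2.2))
    (fun q : bcfun R Y * Y => q.1 q.2)); last exact: bcfun_eval_continuous.
  by apply: continuous_pair; apply: continuous_compose;
    (exact: continuous_fst || exact: continuous_snd).
Qed.

Context (K_usc : usc K) (K_lsc : lsc K) (K_compact : forall x, compact (K x)).

Lemma guaranteed_continuous :
  continuous (fun q : (bcfun R X * bcfun R Y) * X => guaranteed q.1 q.2).
Proof.
(* The perturbation joins the point [x] in the parameter of the infimum. *)
pose F (q : ((bcfun R X * bcfun R Y) * X) * Y) := payoff q.1.1 (q.1.2, q.2).
apply: (@inf_value_continuous _ _ _ (K \o snd) F).
- by apply: usc_comp => //; exact: continuous_snd.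
- by apply: lsc_comp => //; exact: continuous_snd.
- by move=> q; exact: K_compact.
- apply: (@continuous_compose _ _ _
    (fun q : ((bcfun R X * bcfun R Y) * X) * Y => (q.1.1, (q.1.2, q.2)))
    (fun q : (bcfun R X * bcfun R Y) * (X * Y) => payoff q.1 q.2));
    last exact: payoff_continuous.
  apply: continuous_pair; last apply: continuous_pair.
  + exact: continuous_compose (@continuous_fst _ _) (@continuous_fst _ _).
  + exact: continuous_compose (@continuous_fst _ _) (@continuous_snd _ _).
  + exact: continuous_snd.
Qed.

Lemma payoff_continuous_r gh : continuous (payoff gh).
Proof.
apply: (@continuous_compose _ _ _ (fun p : X * Y => (gh, p))
    (fun q : (bcfun R X * bcfun R Y) * (X * Y) => payoff q.1 q.2)).
- by apply: continuous_pair; [exact: cst_continuous|move=> ?; exact: cvg_id].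
- exact: payoff_continuous.
Qed.

Lemma guaranteed_continuous_r gh : continuous (guaranteed gh).
Proof.
apply: (@continuous_compose _ _ _ (fun x : X => (gh, x))
    (fun q : (bcfun R X * bcfun R Y) * X => guaranteed q.1 q.2)).
- by apply: continuous_pair; [exact: cst_continuous|move=> ?; exact: cvg_id].
- exact: guaranteed_continuous.
Qed.

(** An approximate solution with error [e] becomes an exact one after a
perturbation of size at most [2 * e]; the bound on the value function rises by
[e] when [h] is modified, which is why the second truncation is at [2 * e]. *)
Lemma solution_by_perturbation gh p (a e d : R) : (0 <= e)%R -> (2 * e < d)%R ->
  K p.1 p.2 -> payoff gh p = a%:E ->
  (a - e)%:E <= guaranteed gh p.1 ->
  (forall x, guaranteed gh x <= (a + e)%:E) ->
  exists2 gh', ball gh d gh' & solution_map f K gh' p.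
Proof.
case: gh p => g h [x0 y0] /= e0 ed Kp Fa aw wa.
(* The penalty [k] lifts every payoff over [K x0] to at least [a]. *)
have [|k [ke k0 kz kge]] :=
    @bcfun_truncation _ _ (fun y => a%:E - payoff (g, h) (x0, y)) e _ e0.
  move=> y; apply: cvgeB; first by rewrite fin_num_adde_defr.
    exact: cvg_cst.
  apply: (@continuous_compose _ _ _ (fun y : Y => (x0, y)) (payoff (g, h))).
    by apply: continuous_pair; [exact: cst_continuous|move=> ?; exact: cvg_id].
  exact: payoff_continuous_r.
pose h' := (h + k)%R.
have h'E y : h' y = (h y + k y)%R by [].
have hh' : (h - h' = - k)%R by rewrite opprD addrA subrr add0r.
clearbody h'.
have wx0 : a%:E <= guaranteed (g, h') x0.
  apply: inf_value_ge => y Ky.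
  have := le_trans aw (inf_value_le (payoff (g, h)) Ky).
  have := kge y; rewrite /payoff /= h'E.
  case: (f (x0, y)) => [r|_ _|_ //]; last exact: leey.
  rewrite -!(EFinD, EFinN) !lee_fin => kgey aey.
  have : (a - (r + g x0 + h y) <= k y)%R by apply: kgey; lra.
  by move=> ?; lra.
have wh' x : guaranteed (g, h') x <= (a + 2 * e)%:E.
  apply: (@le_trans _ _ (guaranteed (g, h) x + e%:E)).
    apply: inf_value_leD => y _; apply: payoff_leD => /=.
    have : (k y <= e)%R.
      exact: le_trans (ler_norm _) (le_trans (bcfun_le_norm k y) ke).
    by rewrite h'E; lra.
  apply: (le_trans (leeD2r _ (wa x))); rewrite -EFinD lee_fin; lra.
have e20 : (0 <= 2 * e)%R by lra.
(* The penalty [l] cuts the new value function down to at most [a]. *)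
have [|l [le l0 lz lge]] :=
    @bcfun_truncation _ _ (fun x => guaranteed (g, h') x - a%:E) (2 * e) _ e20.
  move=> x; apply: cvgeB; first by rewrite fin_num_adde_defl.
    exact: guaranteed_continuous_r.
  exact: cvg_cst.
pose g' := (g - l)%R.
have g'E x : g' x = (g x - l x)%R by [].
have gg' : (g - g' = l)%R by rewrite opprB addrC subrK.
clearbody g'.
have ky0 : k y0 = 0%R by apply: kz; rewrite Fa subee.
have Fa' : payoff (g, h') (x0, y0) = a%:E.
  by rewrite -Fa /payoff /= h'E ky0 addr0.
have wx0a : guaranteed (g, h') x0 = a%:E.
  by apply/eqP; rewrite eq_le wx0 andbT -Fa'; exact: inf_value_le.
have lx0 : l x0 = 0%R by apply: lz; rewrite wx0a subee.
exists (g', h').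
  by split; rewrite -ball_normE /= ?gg' ?hh' ?normrN; lra.
have Fa'' : payoff (g', h') (x0, y0) = a%:E.
  by rewrite -Fa' /payoff /= g'E lx0 subr0.
apply/supinf_solutionP; split => //=.
- rewrite -/(payoff (g', h')) -/(payoff (g', h') (x0, y0)) Fa''.
  apply: inf_value_ge => y Ky.
  apply: (le_trans (le_trans wx0 (inf_value_le _ Ky))).
  by rewrite -[leRHS]adde0; apply: payoff_leD; rewrite /= g'E lx0; lra.
- move=> x; rewrite -/(payoff (g', h')) -/(payoff (g', h') (x0, y0)) Fa''.
  apply: (@le_trans _ _ (guaranteed (g, h') x + (- l x)%:E)).
    by apply: inf_value_leD => y _; apply: payoff_leD; rewrite /= g'E; lra.
  have := lge x; have := wh' x.
  case: (guaranteed (g, h') x) => [r|//|_ _]; last exact: leNye.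
  rewrite -!(EFinD, EFinN) !lee_fin => rae lgex.
  have : (r - a <= l x)%R by apply: lgex; lra.
  by move=> ?; lra.
Qed.

(** * Properties of the solution map *)

Context (w_bounded : exists M : R, forall x, inf_value K f x <= M%:E).
Context (w_proper : exists x, inf_value K f x \is a fin_num).

Lemma solution_map_fin gh p : solution_map f K gh p ->
  exists m : R, payoff gh p = m%:E.
Proof.
case=> _ Fw wv; have [v vE] := supinf_value_fin gh w_bounded w_proper.
by exists v; rewrite /payoff Fw wv vE.
Qed.

(** A nearly optimal [x], then a nearly optimal response [y] to it, form an
approximate solution. *)
Lemma solution_map_dense : dense (svdom (solution_map f K)).
Proof.
move=> O [gh Ogh] oO.
have /nbhs_ballP[d /= d0 dO] : nbhs gh O by exact: open_nbhs_nbhs.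
have [v vE] := supinf_value_fin gh w_bounded w_proper.
have wv x : guaranteed gh x <= v%:E.
  by rewrite -vE; apply: ereal_sup_ubound; exists x.
pose e := (d / 3)%R.
have e0 : (0 < e)%R by rewrite divr_gt0.
have : (v - e)%:E < supinf_value K (payoff gh) by rewrite vE lte_fin; lra.
move=> /ereal_sup_gt[_ [x _ <-]] vx.
have [r wr] : exists r : R, guaranteed gh x = r%:E.
  by move: vx (wv x); rewrite -/(guaranteed gh x);
    case: (guaranteed gh x) => [r||] // _ _; exists r.
move: vx; rewrite -/(guaranteed gh x) wr lte_fin => vx.
have : inf_value K (payoff gh) x < (r + e)%:E.
  by rewrite -/(guaranteed gh x) wr lte_fin; lra.
move=> /ereal_inf_lt[_ [y Ky <-]] Fx.
have := inf_value_le (payoff gh) Ky; rewrite -/(guaranteed gh x) wr => rF.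
have [a Fa] : exists a : R, payoff gh (x, y) = a%:E.
  by move: Fx rF; case: (payoff gh (x, y)) => [a||] // _ _; exists a.
move: Fx rF; rewrite Fa !lte_fin !lee_fin => ar ra.
have aw : (a - e)%:E <= guaranteed gh x by rewrite wr lee_fin; lra.
have wa x' : guaranteed gh x' <= (a + e)%:E.
  by apply: le_trans (wv x') _; rewrite lee_fin; lra.
have ed : (2 * e < d)%R by rewrite /e; lra.
have [gh' /dO Ogh' Sgh'] :=
  @solution_by_perturbation gh (x, y) a e d (ltW e0) ed Ky Fa aw wa.
by exists gh'; split => //; exists (x, y).
Qed.

(** The gap between payoff and value is small near an exact solution [p], and
the perturbation lemma turns every nearby point of the graph of [K] into an
exact solution of a problem in [O]. *)
Lemma solution_map_open : open_into (solution_map f K) (svgraph K).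
Proof.
move=> O oO.
exists [set p | svgraph K p -> svimage (solution_map f K) O p]°.
  exact: open_interior.
apply/seteqP; split => [p [gh Ogh Sp]|p [/interior_subset /= /[apply]]//].
have [m Fm] := solution_map_fin Sp.
have [Kp Fw wF] := (supinf_solutionP _ _ _).1 Sp.
split => //.
have /nbhs_ballP[d /= d0 dO] : nbhs gh O by exact: open_nbhs_nbhs.
pose e := (d / 3)%R.
have e0 : (0 < e)%R by rewrite divr_gt0.
have nl : \forall q \near p, (m - e / 2)%:E < payoff gh q.
  apply: near_lt_ereal_fun; [exact: cst_continuous|exact: payoff_continuous_r|].
  by rewrite Fm lte_fin; lra.
have nu : \forall q \near p, payoff gh q < (m + e / 2)%:E.
  apply: near_lt_ereal_fun; [exact: payoff_continuous_r|exact: cst_continuous|].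
  by rewrite Fm lte_fin; lra.
have nw : \forall q \near p, (m - e / 2)%:E < guaranteed gh q.1.
  apply: near_lt_ereal_fun; first exact: cst_continuous.
    apply: continuous_compose; first exact: continuous_fst.
    exact: guaranteed_continuous_r.
  by apply: lt_le_trans Fw; rewrite -/(payoff gh p) Fm lte_fin; lra.
rewrite /interior; near=> q => Kq.
have ql : (m - e / 2)%:E < payoff gh q by near: q.
have qu : payoff gh q < (m + e / 2)%:E by near: q.
have qw : (m - e / 2)%:E < guaranteed gh q.1 by near: q.
have [a Fa] : exists a : R, payoff gh q = a%:E.
  by move: ql qu; case: (payoff gh q) => [a||] // _ _; exists a.
move: ql qu; rewrite Fa !lte_fin => ql qu.
have aw : (a - e)%:E <= guaranteed gh q.1.
  by apply: le_trans (ltW qw); rewrite lee_fin; lra.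
have wa x' : guaranteed gh x' <= (a + e)%:E.
  by apply: le_trans (wF x') _; rewrite -/(payoff gh p) Fm lee_fin; lra.
have ed : (2 * e < d)%R by rewrite /e; lra.
have [gh' /dO Ogh' Sgh'] :=
  @solution_by_perturbation gh q a e d (ltW e0) ed Kq Fa aw wa.
by exists gh'.
Unshelve. all: by end_near. Qed.

Lemma solution_map_closed : @regular_space Y -> hausdorff_space Y ->
  closed (svgraph (solution_map f K)).
Proof.
move=> regY hY.
have -> : svgraph (solution_map f K) =
    [set q | svgraph K q.2] `&`
    [set q | payoff q.1 q.2 <= guaranteed q.1 q.2.1] `&`
    \bigcap_x [set q | guaranteed q.1 x <= payoff q.1 q.2].
  apply/seteqP; split => -[gh p] /=.
    by move=> /supinf_solutionP[Kp Fw wF]; split => // x _; exact: wF.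
  move=> [[Kp Fw] wF]; apply/supinf_solutionP; split => // x.
  exact: (wF x I).
have cg (u : (bcfun R X * bcfun R Y) * (X * Y) -> X) : continuous u ->
    continuous (fun q => guaranteed q.1 (u q)).
  move=> cu; apply: (@continuous_compose _ _ _ (fun q => (q.1, u q))
    (fun q => guaranteed q.1 q.2)); last exact: guaranteed_continuous.
  by apply: continuous_pair => //; exact: continuous_fst.
apply: closedI; first apply: closedI.
- apply: preimage_closed; first by move=> ? _; exact: continuous_snd.
  by apply: svgraph_closed => // x; exact: compact_closed.
- apply: closed_le_ereal_fun; first exact: payoff_continuous.
  apply: cg.
  exact: continuous_compose (@continuous_snd _ _) (@continuous_fst _ _).
- apply: closed_bigI => x _.
  apply: closed_le_ereal_fun; last exact: payoff_continuous.
  by apply: (cg (fun=> x)); exact: cst_continuous.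
Qed.

(** With [m] the value at the given solution, the bump [c] of height [d] at [y0]
brings the value function below [m - d / 2] near [x0], while responses outside
[B] still pay more than [m - d / 4] there: minimizers are confined to [B]. The
bump [b] of height [2 * d] at [x0] lifts the value at [x0] to at least [m + d],
while it stays at most [m] outside [N]: maximizers are confined to [N]. Height
[2 * d] for [b] compensates the loss of [d] caused by [c]. *)
Lemma solution_map_quasi_continuous :
  completely_regular_space X -> completely_regular_space Y ->
  quasi_continuous (solution_map f K).
Proof.
move=> crX crY U V oU oV [[x0 y0] [[[g h] Ugh Sgh] Vp]].
have [m Fm] := solution_map_fin Sgh.
have [/= K0 _ wF] := (supinf_solutionP _ _ _).1 Sgh.
have {}wF x : guaranteed (g, h) x <= m%:E by rewrite -Fm; exact: wF.
have w0 : m%:E <= guaranteed (g, h) x0.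
  by case: Sgh => _ /= Fw _; rewrite /guaranteed -Fw -Fm.
have /nbhs_ballP[e /= e0 eU] : nbhs (g, h) U by exact: open_nbhs_nbhs.
have [[A B] /= [Ax By] AB] : nbhs (x0, y0) V by exact: open_nbhs_nbhs.
pose d := (e / 3)%R.
have d0 : (0 < d)%R by rewrite divr_gt0.
have [c [cn cy0 c0 cB]] :=
  @bcfun_bump _ _ y0 B° d crY (nbhs_interior By) (ltW d0).
pose h1 := (h - c)%R.
have h1E y : h1 y = (h y - c y)%R by [].
have hh1 : (h - h1 = c)%R by rewrite opprB addrC subrK.
clearbody h1.
(* On a neighborhood of [x0] the value drops, but not by responses outside
   [B]. *)
have N1 : \forall x \near x0, guaranteed (g, h1) x < (m - d / 2)%:E.
  apply: near_lt_ereal_fun; first exact: guaranteed_continuous_r.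
    exact: cst_continuous.
  apply: le_lt_trans (inf_value_le _ K0) _.
  apply: (@le_lt_trans _ _ (m%:E + (- d)%:E)).
    by rewrite -Fm; apply: payoff_leD; rewrite /= h1E cy0; lra.
  by rewrite -EFinD lte_fin; lra.
have N2 : \forall x \near x0, forall y, K x y ->
    (snd @^-1` B° `|` [set p | (m - d / 4)%:E < payoff (g, h1) p]) (x, y).
  apply: usc_tube => //.
    apply: openU.
      apply: open_comp; last exact: open_interior.
      by move=> ? _; exact: continuous_snd.
    apply: open_lt_ereal_fun; first exact: cst_continuous.
    exact: payoff_continuous_r.
  move=> y Ky; have [By'|By'] := pselect (B° y); [by left|right].
  rewrite /=; apply: (@lt_le_trans _ _ m%:E); first by rewrite lte_fin; lra.
  apply: le_trans (le_trans w0 (inf_value_le _ Ky)) _.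
  by rewrite -[leRHS]adde0; apply: payoff_leD; rewrite /= h1E cB//; lra.
pose N := [set x | [/\ A x, guaranteed (g, h1) x < (m - d / 2)%:E &
  forall y, K x y -> B° y \/ (m - d / 4)%:E < payoff (g, h1) (x, y)]].
have xN : nbhs x0 N by near=> x; split; near: x.
have d20 : (0 <= 2 * d)%R by lra.
have [b [bn bx0 b0 bN]] := @bcfun_bump _ _ x0 N _ crX xN d20.
pose g1 := (g + b)%R.
have g1E x : g1 x = (g x + b x)%R by [].
have gg1 : (g - g1 = - b)%R by rewrite opprD addrA subrr add0r.
clearbody g1.
(* Perturbations within [n] move payoffs and values by at most [2 * n], and
   [4 * n] is smaller than the gap [d / 4] between [m - d / 2] and
   [m - d / 4]. *)
pose n := (d / 20)%R.
exists (U `&` (ball (g1, h1) n)°); split.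
- by apply: openI => //; exact: open_interior.
- exists (g1, h1); split.
    apply: eU; split; rewrite -ball_normE /=.
      by rewrite gg1 normrN; apply: le_lt_trans bn _; rewrite /d; lra.
    by rewrite hh1; apply: le_lt_trans cn _; rewrite /d; lra.
  by apply: nbhsx_ballx; rewrite /n; lra.
- by move=> ? [].
move=> [x y] [[g2 h2] [_ /interior_subset gh2] Sp].
have [/= Kxy F2w w2F] := (supinf_solutionP _ _ _).1 Sp.
have {}F2w : payoff (g2, h2) (x, y) <= guaranteed (g2, h2) x := F2w.
have {}w2F x' : guaranteed (g2, h2) x' <= payoff (g2, h2) (x, y) := w2F x'.
have near12 x' y' : (`|(g1 x' + h1 y') - (g2 x' + h2 y')| <= 2 * n)%R.
  exact: (@perturbation_ball (g1, h1) (g2, h2) (x', y')).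
have Nx : N x.
  apply: contrapT => /bN bx.
  (* If [x] were outside [N], the point [x0] would be strictly better. *)
  have : m%:E <= guaranteed (g2, h2) x0 + (2 * n - d)%:E.
    apply: le_trans w0 _; apply: inf_value_leD => y' _; apply: payoff_leD => /=.
    have := near12 x0 y'; rewrite g1E h1E bx0 ler_norml => /andP[? ?].
    by have /andP[? ?] := c0 y'; lra.
  have lx : guaranteed (g2, h2) x <= m%:E + (2 * n)%:E.
    apply: (@le_trans _ _ (guaranteed (g, h) x + (2 * n)%:E)).
      apply: inf_value_leD => y' _; apply: payoff_leD => /=.
      have := near12 x y'; rewrite g1E h1E bx ler_norml => /andP[? ?].
      by have /andP[? ?] := c0 y'; lra.
    exact: leeD2r.
  move/le_trans => /(_ _ (leeD2r _ (le_trans (w2F x0) (le_trans F2w lx)))).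
  by rewrite -!EFinD lee_fin /n; lra.
case: Nx => Ax' wx /(_ y Kxy)[By'|Fy].
  by apply: (AB (x, y)); split => //; exact: interior_subset.
(* If [y] were outside [B], it would not be a minimizer over [K x]. *)
exfalso.
have u : payoff (g, h1) (x, y) <= payoff (g2, h2) (x, y) + (2 * n - b x)%:E.
  apply: payoff_leD => /=.
  by have := near12 x y; rewrite g1E ler_norml => /andP[? ?]; lra.
have l : guaranteed (g2, h2) x <= guaranteed (g, h1) x + (2 * n + b x)%:E.
  apply: inf_value_leD => y' _; apply: payoff_leD => /=.
  by have := near12 x y'; rewrite g1E ler_norml => /andP[? ?]; lra.
have := le_trans F2w (le_trans l (leeD2r _ (ltW wx))).
move=> /(leeD2r (2 * n - b x)%:E) /(le_trans u) /(lt_le_trans Fy).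
by rewrite -!EFinD lte_fin /n; lra.
Unshelve. all: by end_near. Qed.

End perturbed_problem.

Theorem proposition2p3 (R : realType) (X Y : topologicalType)
    (crX : completely_regular_space X) (hX : hausdorff_space X)
    (crY : completely_regular_space Y) (hY : hausdorff_space Y)
    (f : X * Y -> \bar R) (K : X -> set Y)
    (K_nonempty : forall x, K x !=set0)
    (w_bounded : exists M : R, forall x, (inf_value K f x <= M%:E)%E)
    (w_proper : exists x, inf_value K f x \is a fin_num)
    (f_cont : continuous f)
    (K_lsc : lsc K) (K_usc : usc K) (K_compact : forall x, compact (K x)) :
  [/\ dense (svdom (solution_map f K)),
      closed (svgraph (solution_map f K)),
      quasi_continuous (solution_map f K) &
      open_into (solution_map f K) (svgraph K)].
Proof.
split.
- exact: solution_map_dense.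
- apply: solution_map_closed => //.
  exact: (completely_regular_regular (R := R)).
- exact: solution_map_quasi_continuous.
- exact: solution_map_open.
Qed.
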